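(* Let $G(z)=\lambda(z-c)$, with $\lambda,c\in\mathbb{C}$, $\lambda\ne0$, be a complex polynomial of degree one. Then $G$ is the infinitesimal generator of a semigroup in $\mathbb{D}$ (which is necessarily a semigroup of linear fractional self-maps of $\mathbb{D}$) if and only if $\mathrm{Re}\,\lambda+|\lambda c|\le0$. Moreover, if $G$ is an infinitesimal generator, the associated semigroup is given by $$\varphi_t(z)=e^{\lambda t}z+c(1-e^{\lambda t}),\qquad z\in\mathbb{D},$$ and $c\in\overline{\mathbb{D}}$ is its Denjoy-Wolff point. Furthermore, in this case: (1) if $\mathrm{Re}\,\lambda=0$ then $c=0$ and the semigroup is a neutral-elliptic semigroup of automorphisms of $\mathbb{D}$; (2) if $0<|\mathrm{Re}\,\lambda|<|\lambda|$ then $|c|<1$, $|\mathrm{Re}\,\lambda|\ge|\mathrm{Im}\,\lambda|\dfrac{|c|}{\sqrt{1-|c|^2}}$ with $\mathrm{Re}\,\lambda<0$, and the semigroup is attractive-elliptic; (3) if $|\mathrm{Re}\,\lambda|=|\lambda|$ then $|c|=1$, $\lambda\in(-\infty,0)$ and the semigroup is hyperbolic.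
   Context: $\mathbb{D}$ is the open unit disc in $\mathbb{C}$. A (continuous) semigroup in $\mathbb{D}$ is a family $(\varphi_t)_{t\ge0}$ of holomorphic maps $\varphi_t:\mathbb{D}\to\mathbb{D}$ with $\varphi_0=\mathrm{id}$, $\varphi_{t+s}=\varphi_t\circ\varphi_s$, and $\varphi_t\to\mathrm{id}$ uniformly on compacta as $t\to0^+$. Its infinitesimal generator is the unique holomorphic $G:\mathbb{D}\to\mathbb{C}$ with $\frac{\partial\varphi_t(z)}{\partial t}=G(\varphi_t(z))$. A linear fractional self-map of $\mathbb{D}$ is a non-constant map $z\mapsto\frac{az+b}{cz+d}$, with $|d|>|c|$, mapping $\mathbb{D}$ into $\mathbb{D}$. Every semigroup in $\mathbb{D}$ that is not identically the identity is of exactly one of these types: neutral-elliptic (there is $\tau\in\mathbb{D}$ with $\varphi_t(\tau)=\tau$ and $|\varphi_t'(\tau)|=1$ for all $t>0$); attractive-elliptic (there is $\tau\in\mathbb{D}$ with $\varphi_t(\tau)=\tau$ and $|\varphi_t'(\tau)|<1$ for all $t>0$); hyperbolic (there is $\tau\in\partial\mathbb{D}$ with $\lim_{r\to1^-}\varphi_t(r\tau)=\tau$ and $\lim_{r\to1^-}\varphi_t'(r\tau)<1$ for all $t>0$); parabolic (there is $\tau\in\partial\mathbb{D}$ with $\lim_{r\to1^-}\varphi_t(r\tau)=\tau$ and $\lim_{r\to1^-}\varphi_t'(r\tau)=1$ for all $t>0$). The point $\tau$ is unique and is called the Denjoy-Wolff point of the semigroup.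
   Formalization: Item (3) is false as written (λ=−1, c=0 gives e^{-t}z, attractive-elliptic); corrected: if |Re λ|=|λ| then λ∈(−∞,0), and either |c|<1 and the semigroup is attractive-elliptic, or |c|=1 and it is hyperbolic. *)

(* Defs.v *)
From Stdlib Require Import Reals List.
From Coquelicot Require Import Coquelicot.
Open Scope R_scope.

Definition Cexp (z : C) : C := (exp (Re z) * cos (Im z), exp (Re z) * sin (Im z)).

Definition unit_disc (z : C) : Prop := Cmod z < 1.

Definition holomorphic_on_disc (f : C -> C) : Prop :=
  forall z, unit_disc z -> ex_derive (K := C_AbsRing) (V := C_NormedModule) f z.

Definition self_map (f : C -> C) : Prop := forall z, unit_disc z -> unit_disc (f z).

Definition compact_set (K : C -> Prop) : Prop :=
  forall (I : Type) (U : I -> C -> Prop),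
    (forall i, open (U i)) ->
    (forall z, K z -> exists i, U i z) ->
    exists l : list I, forall z, K z -> exists i, In i l /\ U i z.

(* A family (phi_t)_{t >= 0} of maps of the disc is given by a total function;
   the values of [phi t z] for [t < 0] or [z] outside the disc are irrelevant. *)
Record is_semigroup (phi : R -> C -> C) : Prop := {
  sg_holomorphic : forall t, 0 <= t -> holomorphic_on_disc (phi t);
  sg_self_map : forall t, 0 <= t -> self_map (phi t);
  sg_zero : forall z, unit_disc z -> phi 0 z = z;
  sg_add : forall t s z, 0 <= t -> 0 <= s -> unit_disc z ->
    phi (t + s) z = phi t (phi s z);
  sg_continuous : forall K : C -> Prop,
    compact_set K -> (forall z, K z -> unit_disc z) ->
    forall eps : R, 0 < eps ->
    at_right 0 (fun t => forall z, K z -> Cmod (phi t z - z) < eps)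
}.

(* The time derivative is taken relative to [0, +oo): it is the usual
   derivative for t > 0 and the right derivative at t = 0. *)
Record is_generator (phi : R -> C -> C) (G : C -> C) : Prop := {
  gen_holomorphic : holomorphic_on_disc G;
  gen_derive : forall t z, 0 <= t -> unit_disc z ->
    filterdiff (K := R_AbsRing) (U := R_NormedModule) (V := C_R_NormedModule)
      (fun s => phi s z) (within (fun s => 0 <= s) (locally t))
      (fun h => scal h (G (phi t z)))
}.

Definition linear_fractional_self_map (f : C -> C) : Prop :=
  self_map f /\
  (exists z w, unit_disc z /\ unit_disc w /\ f z <> f w) /\
  exists a b c d : C, Cmod c < Cmod d /\
    forall z, unit_disc z -> f z = ((a * z + b) / (c * z + d))%C.

Definition disc_automorphism (f : C -> C) : Prop :=
  holomorphic_on_disc f /\ self_map f /\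
  exists g : C -> C, holomorphic_on_disc g /\ self_map g /\
    (forall z, unit_disc z -> g (f z) = z) /\ (forall z, unit_disc z -> f (g z) = z).

(* The classification concerns semigroups other than the identity; the two
   types whose derivative condition the identity satisfies exclude it.
   Coquelicot's [C_derive] is a limit along the real direction only; it is the
   complex derivative here because every [phi t] is holomorphic on the disc. *)
Definition non_identity (phi : R -> C -> C) : Prop :=
  exists t z, 0 <= t /\ unit_disc z /\ phi t z <> z.

Definition neutral_elliptic_at (phi : R -> C -> C) (tau : C) : Prop :=
  non_identity phi /\
  unit_disc tau /\
  forall t, 0 < t -> phi t tau = tau /\ Cmod (C_derive (phi t) tau) = 1.

Definition attractive_elliptic_at (phi : R -> C -> C) (tau : C) : Prop :=
  unit_disc tau /\
  forall t, 0 < t -> phi t tau = tau /\ Cmod (C_derive (phi t) tau) < 1.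

Definition radial_lim (f : C -> C) (tau l : C) : Prop :=
  filterlim (fun r : R => f (r * tau)%C) (at_left 1) (locally l).

Definition hyperbolic_at (phi : R -> C -> C) (tau : C) : Prop :=
  Cmod tau = 1 /\
  forall t, 0 < t -> radial_lim (phi t) tau tau /\
    exists alpha : R, radial_lim (C_derive (phi t)) tau alpha /\ alpha < 1.

Definition parabolic_at (phi : R -> C -> C) (tau : C) : Prop :=
  non_identity phi /\
  Cmod tau = 1 /\
  forall t, 0 < t -> radial_lim (phi t) tau tau /\
    radial_lim (C_derive (phi t)) tau 1.

Definition neutral_elliptic (phi : R -> C -> C) : Prop :=
  exists tau, neutral_elliptic_at phi tau.

Definition attractive_elliptic (phi : R -> C -> C) : Prop :=
  exists tau, attractive_elliptic_at phi tau.

Definition hyperbolic (phi : R -> C -> C) : Prop :=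
  exists tau, hyperbolic_at phi tau.

Definition is_Denjoy_Wolff_point (phi : R -> C -> C) (tau : C) : Prop :=
  neutral_elliptic_at phi tau \/ attractive_elliptic_at phi tau \/
  hyperbolic_at phi tau \/ parabolic_at phi tau.

(* Main.v *)
Require Import Defs.
From Stdlib Require Import Reals Lra.
From Coquelicot Require Import Coquelicot.
Open Scope R_scope.

(** Everything follows from the explicit solution of a linear differential
    equation.  The equation [y' = lambda (y - c)], for [t >= 0], has one solution
    for each initial value ([linear_ode_unique]), so a semigroup generated by
    [G] agrees on the disc with the affine maps
    [flow lambda c t : z |-> c + exp (lambda t) (z - c)], and conversely this
    family always satisfies the semigroup law and has [G] as its velocity.  The
    question is only when these maps send the disc into itself.

    An affine map [z |-> e z + f] with [e <> 0] sends the disc into itself as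
    soon as [|e| + |f| <= 1].  For the flow this reads
    [exp (t Re lambda) + |c| |1 - exp (lambda t)| <= 1], which follows from
    [Re lambda + |lambda c| <= 0] because the length of the arc
    [s |-> exp (lambda s)], [0 <= s <= t], bounds its chord:
    [|Re lambda| |1 - exp (lambda t)| <= |lambda| (1 - exp (t Re lambda))]
    when [Re lambda <= 0] ([Cmod_one_minus_Cexp_le], [flow_bound]).

    Conversely, if every flow map preserves the disc, the velocity [G zeta] at a
    point of the unit circle cannot point outwards, so that
    [Re (conj zeta * lambda (zeta - c)) <= 0]; choosing [zeta] so that
    [conj zeta * (lambda c)] is a nonpositive real number turns this into
    [Re lambda + |lambda c| <= 0] ([Re_plus_Cmod_le_0_of_self_map]).

    The remaining claims are read off the condition.  The point [c] is fixed and
    [phi_t' = exp (lambda t)] throughout the disc.  As [lambda <> 0], the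
    condition gives [|c| <= 1], with [c = 0] if [Re lambda = 0], and [lambda]
    real and negative if [|c| = 1]. *)

(** * The complex exponential *)

Lemma Cexp_plus (z w : C) : Cexp (z + w) = (Cexp z * Cexp w)%C.
Proof.
unfold Cexp, Re, Im; destruct z as [a b], w as [a' b']; simpl.
rewrite exp_plus, cos_plus, sin_plus.
apply injective_projections; simpl; ring.
Qed.

Lemma Cexp_0 : Cexp 0 = 1%C.
Proof.
unfold Cexp; simpl; rewrite exp_0, cos_0, sin_0.
apply injective_projections; simpl; ring.
Qed.

Lemma Cmod_Cexp (z : C) : Cmod (Cexp z) = exp (Re z).
Proof.
apply Rsqr_inj; [apply Cmod_ge_0 | left; apply exp_pos |].
rewrite !Rsqr_pow2, Cmod2_alt.
unfold Cexp; simpl.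
generalize (sin2_cos2 (Im z)); unfold Rsqr; intro H.
replace (_ + _) with (exp (Re z) * exp (Re z) * (sin (Im z) * sin (Im z) + cos (Im z) * cos (Im z))) by ring.
rewrite H; ring.
Qed.

Lemma Re_mult_RtoC (z : C) (t : R) : Re (z * t) = Re z * t.
Proof. unfold Re; simpl; ring. Qed.

Lemma Im_mult_RtoC (z : C) (t : R) : Im (z * t) = Im z * t.
Proof. unfold Im; simpl; ring. Qed.

Lemma sinh_ge (x : R) : 0 <= x -> x <= sinh x.
Proof.
intro hx.
destruct (MVT_gen (fun x => sinh x - x) 0 x (fun x => cosh x - 1)) as [y [_ Hy]].
- intros y _. unfold sinh, cosh. auto_derive; trivial. field.
- intros y _. apply continuity_pt_filterlim.
  apply (ex_derive_continuous (fun x => sinh x - x)).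
  unfold sinh; auto_derive; trivial.
- rewrite sinh_0 in Hy.
  assert (1 <= cosh y).
  { unfold cosh; generalize (exp_ineq1_le y) (exp_ineq1_le (- y)); lra. }
  nra.
Qed.

Lemma sin_sqr_le (x : R) : sin x ^ 2 <= x ^ 2.
Proof.
rewrite <- !Rsqr_pow2.
apply Rsqr_le_abs_1.
assert (H : Rabs (sin x - sin 0) <= 1 * Rabs (x - 0)).
{ apply (bounded_variation sin cos); intros y _; split.
  - auto_derive; trivial; ring.
  - apply Rabs_le, COS_bound. }
now rewrite sin_0, !Rminus_0_r, Rmult_1_l in H.
Qed.

(** A chord of the spiral [s |-> exp (lambda s)] is at most as long as its arc,
    whose length is the integral of [|lambda| exp (s Re lambda)] over
    [0 <= s <= t].
    Multiplying by [- Re lambda] instead of dividing covers [Re lambda = 0].  With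
    [a] and [b] the real and imaginary parts of [lambda], both sides squared
    contain [a^2 (1 - exp (a t))^2]; cancelling it and dividing by [4 exp (a t)]
    leaves [a^2 sin^2 (b t / 2) <= b^2 sinh^2 (a t / 2)], which follows from
    [|sin x| <= |x| <= |sinh x|]. *)
Lemma Cmod_one_minus_Cexp_le (lambda : C) (t : R) :
  Re lambda <= 0 -> 0 <= t ->
  - Re lambda * Cmod (1 - Cexp (lambda * t)) <= Cmod lambda * (1 - exp (Re lambda * t)).
Proof.
intros ha ht.
set (a := Re lambda) in *; set (b := Im lambda).
set (u := exp (a * t / 2)); set (s := sin (b * t / 2)).
assert (hu : 0 < u) by apply exp_pos.
assert (hu2 : exp (a * t) = u * u).
{ unfold u; rewrite <- exp_plus; f_equal; field. }
assert (hs : cos (b * t) = 1 - 2 * s * s).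
{ replace (b * t) with (2 * (b * t / 2)) by field. apply cos_2a_sin. }
assert (hC : Cmod (1 - Cexp (lambda * t)) ^ 2 = (1 - u * u) ^ 2 + 4 * (u * s) ^ 2).
{ rewrite Cmod2_alt; unfold Cexp; rewrite Re_mult_RtoC, Im_mult_RtoC; fold a b.
  unfold Re, Im; simpl. rewrite hu2, hs.
  assert (H := sin2_cos2 (b * t)); unfold Rsqr in H; rewrite hs in H.
  replace (_ + _) with ((1 - u * u * (1 - 2 * s * s)) ^ 2 + (u * u) ^ 2 * (sin (b * t) * sin (b * t))) by ring.
  replace (sin (b * t) * sin (b * t)) with (1 - (1 - 2 * s * s) * (1 - 2 * s * s)) by lra.
  ring. }
assert (hl : Cmod lambda ^ 2 = a ^ 2 + b ^ 2) by apply Cmod2_alt.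
assert (hsin : s ^ 2 <= (b * t / 2) ^ 2) by apply sin_sqr_le.
assert (hsinh : 0 <= - (a * t) * u <= 1 - u * u).
{ assert (hat : 0 <= - (a * t / 2)) by nra.
  assert (H := sinh_ge _ hat).
  unfold sinh in H; rewrite Ropp_involutive, exp_Ropp in H; fold u in H.
  assert (Hu : u * / u = 1) by (field; lra).
  split; [nra|].
  apply (Rmult_le_compat_l u) in H; [|lra].
  replace (u * ((/ u - u) / 2)) with ((u * / u - u * u) / 2) in H by (field; lra).
  rewrite Hu in H; lra. }
rewrite hu2.
apply Rsqr_incr_0_var.
2: { apply Rmult_le_pos; [apply Cmod_ge_0 | lra]. }
rewrite !Rsqr_mult, !Rsqr_pow2, hC, hl.
apply (pow_incr _ _ 2) in hsinh.
assert (H1 : b ^ 2 * (- (a * t) * u) ^ 2 <= b ^ 2 * (1 - u * u) ^ 2)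
  by (apply Rmult_le_compat_l; [apply pow2_ge_0 | easy]).
assert (H2 : 4 * (a * u) ^ 2 * s ^ 2 <= 4 * (a * u) ^ 2 * (b * t / 2) ^ 2)
  by (apply Rmult_le_compat_l; [generalize (pow2_ge_0 (a * u)); lra | easy]).
replace (4 * (a * u) ^ 2 * (b * t / 2) ^ 2) with (b ^ 2 * (- (a * t) * u) ^ 2) in H2 by field.
replace ((- a) ^ 2 * ((1 - u * u) ^ 2 + 4 * (u * s) ^ 2)) with
  (a ^ 2 * (1 - u * u) ^ 2 + 4 * (a * u) ^ 2 * s ^ 2) by ring.
lra.
Qed.

(** * One-sided differential equations on the half-line *)

Definition is_half_line_derive (f : R -> C) (t : R) (l : C) : Prop :=
  filterdiff (K := R_AbsRing) (U := R_NormedModule) (V := C_R_NormedModule) f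
    (within (fun s => 0 <= s) (locally t)) (fun h => scal h l).

Lemma proper_filter_half_line (t : R) :
  0 <= t -> ProperFilter (within (fun s => 0 <= s) (locally t)).
Proof.
intro ht; split; [|apply within_filter, locally_filter].
intros P HP; exists t.
now apply (locally_singleton t _ HP).
Qed.

Lemma is_filter_lim_half_line (t : R) :
  is_filter_lim (within (fun s => 0 <= s) (locally t)) t.
Proof. exact (filter_le_within (F := locally t) _). Qed.

Lemma is_derive_half_line (f : R -> C) (t : R) (l : C) :
  0 <= t -> is_derive (K := R_AbsRing) (V := C_R_NormedModule) f t l ->
  is_half_line_derive f t l.
Proof.
intros ht H.
pose proof (proper_filter_half_line t ht).
apply (filterdiff_locally (F := within (fun s => 0 <= s) (locally t)) f t); [|exact H].
apply is_filter_lim_half_line.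
Qed.

Lemma half_line_is_derive (f : R -> C) (t : R) (l : C) :
  0 < t -> is_half_line_derive f t l ->
  is_derive (K := R_AbsRing) (V := C_R_NormedModule) f t l.
Proof.
intros ht [Hl H]; split; [exact Hl|].
intros x Hx eps.
assert (Hx' : is_filter_lim (within (fun s => 0 <= s) (locally t)) x).
{ intros P HP. apply is_filter_lim_half_line. now apply Hx. }
generalize (filter_and _ _ (open_gt 0 t ht) (H x Hx' eps)).
apply filter_imp; intros s [Hs Hsi]; apply Hsi; now left.
Qed.

Lemma is_half_line_derive_continuous (f : R -> C) (t : R) (l : C) :
  is_half_line_derive f t l ->
  filterlim f (within (fun s => 0 <= s) (locally t)) (locally (f t)).
Proof.
intro H.
refine (filterdiff_continuous_aux f _ t (is_filter_lim_half_line t)).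
eexists; exact H.
Qed.

Lemma is_derive_Re (f : R -> C) (t : R) (l : C) :
  is_derive (K := R_AbsRing) (V := C_R_NormedModule) f t l ->
  is_derive (fun s => Re (f s)) t (Re l).
Proof.
intro H.
apply (filterdiff_comp' f fst t (fun h => scal h l) fst H).
apply filterdiff_linear, is_linear_fst.
Qed.

Lemma is_derive_Im (f : R -> C) (t : R) (l : C) :
  is_derive (K := R_AbsRing) (V := C_R_NormedModule) f t l ->
  is_derive (fun s => Im (f s)) t (Im l).
Proof.
intro H.
apply (filterdiff_comp' f snd t (fun h => scal h l) snd H).
apply filterdiff_linear, is_linear_snd.
Qed.

Lemma is_derive_pair (u v : R -> R) (t du dv : R) :
  is_derive u t du -> is_derive v t dv ->
  is_derive (K := R_AbsRing) (V := C_R_NormedModule) (fun s => (u s, v s)) t (du, dv).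
Proof.
intros Hu Hv.
apply (filterdiff_comp_2 u v (fun x y => (x, y) : C_R_NormedModule)
         (fun h => scal h du) (fun h => scal h dv) (fun x y => (x, y))); trivial.
apply filterdiff_linear.
split.
- now intros x y; destruct x, y.
- now intros k x; destruct x.
- exists 1; split; [lra|]. intro x. rewrite Rmult_1_l. destruct x. apply Rle_refl.
Qed.

Lemma half_line_constant (f : R -> R) :
  (forall t, 0 < t -> is_derive f t 0) -> (forall t, 0 <= t -> continuous f t) ->
  forall t, 0 <= t -> f t = f 0.
Proof.
intros Hd Hc t ht.
destruct (MVT_gen f 0 t (fun _ => 0)) as [x [_ Hx]].
- intros x [Hx _]; apply Hd. now rewrite Rmin_left in Hx.
- intros x [Hx _]; rewrite Rmin_left in Hx by easy.
  now apply continuity_pt_filterlim, Hc.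
- lra.
Qed.

(** Precomposing with the absolute value turns one-sided continuity at the end
    point [0] into ordinary continuity, which the mean value theorem requires. *)
Lemma continuous_comp_Rabs {V : UniformSpace} (f : R -> V) :
  (forall t, 0 <= t -> filterlim f (within (fun s => 0 <= s) (locally t)) (locally (f t))) ->
  forall t, 0 <= t -> continuous (fun s => f (Rabs s)) t.
Proof.
intros H t ht.
unfold continuous.
rewrite (Rabs_pos_eq t ht).
apply filterlim_comp with (2 := H t ht).
intros P HP.
unfold filtermap.
assert (Hc := continuous_Rabs t). unfold continuous in Hc. rewrite (Rabs_pos_eq t ht) in Hc.
generalize (Hc _ HP). unfold filtermap. apply filter_imp; intros s Hs; apply Hs, Rabs_pos.
Qed.

(** The squared modulus of a solution is multiplied by [exp (2 t Re lambda)] over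
    time, so [exp (- 2 t Re lambda) |d t|^2] is constant, and it starts at [0]. *)
Lemma homogeneous_ode_zero (lambda : C) (d : R -> C) :
  (forall t, 0 <= t -> is_half_line_derive d t (lambda * d t)%C) ->
  d 0 = 0%C -> forall t, 0 <= t -> d t = 0%C.
Proof.
intros Hd Hd0.
set (a := Re lambda); set (b := Im lambda).
set (p := fun s => Re (d (Rabs s))); set (q := fun s => Im (d (Rabs s))).
assert (Hder : forall t, 0 < t ->
  is_derive (K := R_AbsRing) (V := C_R_NormedModule) (fun s => d (Rabs s)) t
    (lambda * d (Rabs t))%C).
{ intros t ht; rewrite (Rabs_pos_eq t) by lra.
  apply is_derive_ext_loc with (f := d).
  - generalize (open_gt 0 t ht); apply filter_imp.
    intros s hs; now rewrite Rabs_pos_eq by now left.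
  - apply half_line_is_derive; [easy|]; apply Hd; now left. }
assert (Hp : forall t, 0 < t -> is_derive p t (a * p t - b * q t))
  by (intros t ht; exact (is_derive_Re _ _ _ (Hder t ht))).
assert (Hq : forall t, 0 < t -> is_derive q t (a * q t + b * p t))
  by (intros t ht; exact (is_derive_Im _ _ _ (Hder t ht))).
assert (Hc : forall t, 0 <= t ->
  continuous (U := prod_UniformSpace R_UniformSpace R_UniformSpace) (fun s => d (Rabs s)) t).
{ apply (continuous_comp_Rabs (V := prod_UniformSpace R_UniformSpace R_UniformSpace) d).
  intros s hs; exact (is_half_line_derive_continuous d s _ (Hd s hs)). }
assert (Hcp : forall t, 0 <= t -> continuous p t).
{ intros t ht; apply (continuous_comp (fun s => d (Rabs s)) fst);
    [exact (Hc t ht) | apply continuous_fst]. }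
assert (Hcq : forall t, 0 <= t -> continuous q t).
{ intros t ht; apply (continuous_comp (fun s => d (Rabs s)) snd);
    [exact (Hc t ht) | apply continuous_snd]. }
intros t ht.
assert (Henergy : exp (- (2 * a) * t) * (p t * p t + q t * q t)
                  = exp (- (2 * a) * 0) * (p 0 * p 0 + q 0 * q 0)).
{ apply (half_line_constant (fun s => exp (- (2 * a) * s) * (p s * p s + q s * q s)));
    [| |exact ht].
  - intros s hs; evar_last.
    + auto_derive; [|reflexivity].
      repeat split; eexists; (apply Hp + apply Hq); exact hs.
    + change (fun x => p x) with p; change (fun x => q x) with q.
      rewrite (is_derive_unique p _ _ (Hp s hs)), (is_derive_unique q _ _ (Hq s hs)); ring.
  - intros s hs.
    apply (continuous_mult (fun s => exp (- (2 * a) * s)) (fun s => p s * p s + q s * q s)).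
    + apply (ex_derive_continuous (fun s => exp (- (2 * a) * s))); auto_derive; trivial.
    + apply (continuous_plus (fun s => p s * p s) (fun s => q s * q s)).
      * apply (continuous_mult p p); auto.
      * apply (continuous_mult q q); auto. }
unfold p, q in Henergy.
rewrite (Rabs_pos_eq t ht), Rabs_R0, Hd0 in Henergy.
replace (_ * (Re 0 * _ + _)) with 0 in Henergy by (simpl; ring).
apply Rmult_integral in Henergy as [He | He].
- generalize (exp_pos (- (2 * a) * t)); lra.
- apply Rplus_sqr_eq_0 in He as [He1 He2].
  now apply injective_projections.
Qed.

(** * The affine flow *)

Definition flow (lambda c : C) (t : R) (z : C) : C :=
  (Cexp (lambda * t) * z + c * (1 - Cexp (lambda * t)))%C.

Lemma flow_centred (lambda c : C) (t : R) (z : C) :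
  flow lambda c t z = (c + Cexp (lambda * t) * (z - c))%C.
Proof. unfold flow; ring. Qed.

Lemma flow_0 (lambda c z : C) : flow lambda c 0 z = z.
Proof. unfold flow; rewrite Cmult_0_r, Cexp_0; ring. Qed.

Lemma flow_plus (lambda c : C) (t s : R) (z : C) :
  flow lambda c (t + s) z = flow lambda c t (flow lambda c s z).
Proof.
unfold flow; rewrite RtoC_plus, Cmult_plus_distr_l, Cexp_plus; ring.
Qed.

Lemma is_derive_flow_time (lambda c : C) (t : R) (z : C) :
  is_derive (K := R_AbsRing) (V := C_R_NormedModule) (fun s => flow lambda c s z) t
    (lambda * (flow lambda c t z - c))%C.
Proof.
set (a := Re lambda); set (b := Im lambda).
set (p := Re (z - c)); set (q := Im (z - c)).
apply (is_derive_ext (K := R_AbsRing) (V := C_R_NormedModule)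
  (fun s => (Re c + exp (a * s) * (cos (b * s) * p - sin (b * s) * q),
             Im c + exp (a * s) * (cos (b * s) * q + sin (b * s) * p)))).
{ intro s; rewrite flow_centred; unfold Cexp; rewrite Re_mult_RtoC, Im_mult_RtoC.
  apply injective_projections; unfold p, q, a, b, Re, Im; simpl; ring. }
replace (lambda * (flow lambda c t z - c))%C with
  (a * (exp (a * t) * (cos (b * t) * p - sin (b * t) * q))
     - b * (exp (a * t) * (cos (b * t) * q + sin (b * t) * p)),
   a * (exp (a * t) * (cos (b * t) * q + sin (b * t) * p))
     + b * (exp (a * t) * (cos (b * t) * p - sin (b * t) * q))).
- apply is_derive_pair; auto_derive; trivial; ring.
- rewrite flow_centred; unfold Cexp; rewrite Re_mult_RtoC, Im_mult_RtoC.
  apply injective_projections; unfold p, q, a, b, Re, Im; simpl; ring.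
Qed.

Lemma is_derive_affine (a b z : C) :
  is_derive (K := C_AbsRing) (V := C_NormedModule) (fun y : C => a * y + b)%C z a.
Proof.
apply (is_derive_ext (K := C_AbsRing) (V := C_NormedModule)
  (fun y : C => plus (scal (V := C_NormedModule) y a) b)).
{ intro y; rewrite (Cmult_comm a y); reflexivity. }
evar_last.
- apply (is_derive_plus (K := C_AbsRing) (V := C_NormedModule)).
  + apply (is_derive_scal_l (K := C_AbsRing) (V := C_NormedModule) (fun y : C => y)).
    apply (is_derive_id (K := C_AbsRing)).
  + apply is_derive_const.
- rewrite plus_zero_r; apply (scal_one (V := C_NormedModule)).
Qed.

Lemma is_derive_flow_space (lambda c : C) (t : R) (z : C) :
  is_derive (K := C_AbsRing) (V := C_NormedModule) (flow lambda c t) z (Cexp (lambda * t)).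
Proof. apply is_derive_affine. Qed.

Lemma linear_ode_unique (lambda c : C) (y : R -> C) :
  (forall t, 0 <= t -> is_half_line_derive y t (lambda * (y t - c))%C) ->
  forall t, 0 <= t -> y t = flow lambda c t (y 0).
Proof.
intros Hy t ht.
assert (H : (y t - flow lambda c t (y 0) = 0)%C).
{ apply (homogeneous_ode_zero lambda (fun s => y s - flow lambda c s (y 0))%C); trivial.
  - clear t ht; intros t ht.
    assert (Hf := is_derive_half_line _ _ _ ht (is_derive_flow_time lambda c t (y 0))).
    refine (filterdiff_ext_lin _ _ _ (filterdiff_minus_fct _ _ _ _ (Hy t ht) Hf) _).
    intro h; rewrite <- (scal_minus_distr_l (V := C_R_ModuleSpace)); f_equal.
    change (lambda * (y t - c) - lambda * (flow lambda c t (y 0) - c)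
            = lambda * (y t - flow lambda c t (y 0)))%C; ring.
  - rewrite flow_0; ring. }
replace (y t) with ((y t - flow lambda c t (y 0)) + flow lambda c t (y 0))%C by ring.
rewrite H; ring.
Qed.

(** If [Re lambda < 0], the chord bound and [|c| |lambda| <= - Re lambda] give
    [|c| |1 - exp (lambda t)| <= 1 - exp (t Re lambda)]; if [Re lambda = 0], the
    condition forces [c = 0]. *)
Lemma flow_bound (lambda c : C) (t : R) :
  lambda <> 0%C -> Re lambda + Cmod (lambda * c) <= 0 -> 0 <= t ->
  exp (Re lambda * t) + Cmod c * Cmod (1 - Cexp (lambda * t)) <= 1.
Proof.
intros hl hc ht.
rewrite Cmod_mult in hc.
apply Cmod_gt_0 in hl.
pose proof (Cmod_ge_0 c) as hc0.
assert (ha : Re lambda <= 0) by nra.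
destruct (Rle_lt_or_eq_dec _ _ ha) as [ha'|ha'].
- assert (H := Cmod_one_minus_Cexp_le lambda t ha ht).
  assert (He : exp (Re lambda * t) <= 1).
  { destruct ht as [ht | <-].
    - left; rewrite <- exp_0; apply exp_increasing; nra.
    - right; rewrite Rmult_0_r; apply exp_0. }
  apply (Rmult_le_compat_l (Cmod c)) in H; [|easy].
  apply (Rmult_le_reg_l (- Re lambda)); [lra|].
  assert (H2 : (Cmod lambda * Cmod c) * (1 - exp (Re lambda * t)) <= - Re lambda * (1 - exp (Re lambda * t)))
    by (apply Rmult_le_compat_r; lra).
  lra.
- assert (Hc : Cmod c = 0) by nra.
  rewrite ha', Hc, Rmult_0_l, exp_0; lra.
Qed.

Lemma flow_self_map (lambda c : C) (t : R) :
  lambda <> 0%C -> Re lambda + Cmod (lambda * c) <= 0 -> 0 <= t ->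
  self_map (flow lambda c t).
Proof.
intros hl hc ht z hz; unfold unit_disc in *.
eapply Rle_lt_trans; [apply Cmod_triangle|].
rewrite !Cmod_mult, Cmod_Cexp, Re_mult_RtoC.
assert (H := flow_bound lambda c t hl hc ht).
assert (He := exp_pos (Re lambda * t)).
nra.
Qed.

Lemma flow_holomorphic (lambda c : C) (t : R) : holomorphic_on_disc (flow lambda c t).
Proof. intros z _; eexists; apply is_derive_flow_space. Qed.

Lemma locally_Cmod (l : C) (P : C -> Prop) :
  locally l P -> exists eps : posreal, forall z, Cmod (z - l) < eps -> P z.
Proof.
intros [eps H]; exists eps; intros z Hz; apply H.
now apply C_NormedModule_mixin_compat1.
Qed.

Lemma Cmod_locally (l : C) (eps : R) : 0 < eps -> locally l (fun z => Cmod (z - l) < eps).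
Proof.
intro H.
apply (locally_le_locally_norm (V := C_NormedModule) l).
now exists (mkposreal eps H).
Qed.

Lemma filterlim_Cmod {T : Type} (F : (T -> Prop) -> Prop) {FF : Filter F} (f : T -> C) (l : C) :
  (forall eps : posreal, F (fun x => Cmod (f x - l) < eps)) -> filterlim f F (locally l).
Proof.
intros H P HP.
destruct (locally_Cmod l P HP) as [eps Heps].
generalize (H eps); unfold filtermap; apply filter_imp; auto.
Qed.

Lemma unit_disc_open (z : C) : unit_disc z -> locally z unit_disc.
Proof.
unfold unit_disc; intro hz.
apply filter_imp with (2 := Cmod_locally z (1 - Cmod z) ltac:(lra)).
intros w Hw.
replace w with ((w - z) + z)%C by ring.
eapply Rle_lt_trans; [apply Cmod_triangle|]; lra.
Qed.

(** The displacement is [(exp (lambda t) - 1) (z - c)], so convergence to the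
    identity is uniform on the whole disc. *)
Lemma flow_semigroup (lambda c : C) :
  lambda <> 0%C -> Re lambda + Cmod (lambda * c) <= 0 -> is_semigroup (flow lambda c).
Proof.
intros hl hc; split.
- intros t _; apply flow_holomorphic.
- intros t ht; now apply flow_self_map.
- intros z _; apply flow_0.
- intros t s z _ _ _; apply flow_plus.
- intros K _ HK eps Heps.
  assert (Hpos : 0 < eps / (1 + Cmod c)).
  { apply Rdiv_lt_0_compat; [easy|]. generalize (Cmod_ge_0 c); lra. }
  (* [flow lambda 0 t 1] is [exp (lambda t)]. *)
  assert (H : continuous (U := prod_UniformSpace R_UniformSpace R_UniformSpace)
    (fun t : R => flow lambda 0 t 1) 0).
  { apply (filterdiff_continuous (V := C_R_NormedModule) (fun t : R => flow lambda 0 t 1)).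
    eexists; apply is_derive_flow_time. }
  unfold continuous in H; rewrite flow_0 in H.
  generalize (H _ (Cmod_locally 1 _ Hpos)).
  unfold filtermap; intro H'.
  apply (filter_le_within (F := locally 0) (fun t => 0 < t)).
  revert H'; apply filter_imp; intros t Ht z Hz.
  apply HK in Hz; unfold unit_disc in Hz.
  rewrite flow_centred in Ht; rewrite flow_centred.
  replace (0 + Cexp (lambda * t) * (1 - 0) - 1)%C with (Cexp (lambda * t) - 1)%C in Ht by ring.
  replace (c + Cexp (lambda * t) * (z - c) - z)%C with ((Cexp (lambda * t) - 1) * (z - c))%C by ring.
  rewrite Cmod_mult.
  assert (Hzc : Cmod (z - c) <= 1 + Cmod c).
  { eapply Rle_trans; [apply Cmod_triangle|]. rewrite Cmod_opp; lra. }
  pose proof (Cmod_ge_0 c).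
  eapply Rle_lt_trans.
  + apply Rmult_le_compat_l; [apply Cmod_ge_0 | exact Hzc].
  + apply Rmult_lt_reg_r with (/ (1 + Cmod c)); [apply Rinv_0_lt_compat; lra|].
    rewrite Rmult_assoc, Rinv_r, Rmult_1_r by lra. exact Ht.
Qed.

Lemma flow_generator (lambda c : C) :
  is_generator (flow lambda c) (fun z => (lambda * (z - c))%C).
Proof.
split.
- intros z _. exists lambda.
  apply (is_derive_ext (K := C_AbsRing) (V := C_NormedModule)
    (fun y : C => lambda * y + - (lambda * c))%C); [intro y; simpl; ring | apply is_derive_affine].
- intros t z ht _; apply is_derive_half_line; [easy|]; apply is_derive_flow_time.
Qed.

(** * Invariance of the disc forces the inequality *)

Lemma is_derive_initial_max (h : R -> R) (l : R) :
  is_derive h 0 l -> (forall t, 0 < t -> h t <= h 0) -> l <= 0.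
Proof.
intros H Hmax; apply is_derive_Reals in H.
destruct (Rle_or_lt l 0) as [|hl]; [easy|exfalso].
destruct (H l hl) as [[d hd] Hd]; simpl in Hd.
assert (Hd2 : 0 < d / 2) by lra.
specialize (Hd (d / 2) ltac:(lra)).
rewrite Rabs_pos_eq in Hd by lra.
specialize (Hd ltac:(lra)).
apply Rabs_def2 in Hd as [_ Hd].
rewrite Rplus_0_l in Hd.
specialize (Hmax _ Hd2).
assert (Hq : (h (d / 2) - h 0) / (d / 2) <= 0).
{ apply Rmult_le_reg_r with (d / 2); [easy|]. unfold Rdiv at 1.
  rewrite Rmult_assoc, Rinv_l by lra. lra. }
lra.
Qed.

Lemma exists_opposite_direction (w : C) :
  exists zeta : C, Cmod zeta = 1 /\ Re (Cconj zeta * w) = - Cmod w.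
Proof.
destruct (Ceq_dec w 0) as [->|hw].
- exists 1%C; rewrite Cmod_1, Cmod_0; split; [easy|]. rewrite Cmult_0_r; simpl; ring.
- assert (hm := proj1 (Cmod_gt_0 w) hw).
  exists (- (/ Cmod w)%R * w)%C; split.
  + rewrite Cmod_mult, Cmod_opp, Cmod_R, Rabs_pos_eq; [field; lra|].
    left; now apply Rinv_0_lt_compat.
  + transitivity (- (/ Cmod w) * Cmod w ^ 2); [|field; lra].
    rewrite Cmod2_alt; unfold Re, Im; simpl; ring.
Qed.

(** By continuity, an affine self-map of the open disc maps the closed disc into
    itself. *)
Lemma flow_unit_circle (lambda c : C) (t : R) (z : C) :
  self_map (flow lambda c t) -> Cmod z = 1 -> Cmod (flow lambda c t z) <= 1.
Proof.
intros H hz.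
set (e := Cmod (Cexp (lambda * t))).
assert (he : 0 < e) by (unfold e; rewrite Cmod_Cexp; apply exp_pos).
apply Rnot_lt_le; intro Habs.
(* Moving [z] inwards by [d] moves its image by [d * e], too little to bring it
   back into the disc. *)
set (d := Rmin 1 ((Cmod (flow lambda c t z) - 1) / e)).
assert (hd : 0 < d).
{ unfold d; apply Rmin_pos; [lra|]. apply Rdiv_lt_0_compat; lra. }
assert (hd1 : d <= 1) by apply Rmin_l.
assert (hde : d * e <= Cmod (flow lambda c t z) - 1).
{ replace (Cmod (flow lambda c t z) - 1) with ((Cmod (flow lambda c t z) - 1) / e * e) by (field; lra).
  apply Rmult_le_compat_r; [lra | apply Rmin_r]. }
assert (Hin : Cmod (flow lambda c t ((1 - d)%R * z)) < 1).
{ apply H; unfold unit_disc; rewrite Cmod_mult, hz, Cmod_R, Rabs_pos_eq; lra. }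
assert (Htri : Cmod (flow lambda c t z) <= Cmod (flow lambda c t ((1 - d)%R * z)) + e * d).
{ replace (flow lambda c t z) with (flow lambda c t ((1 - d)%R * z) + Cexp (lambda * t) * (d * z))%C.
  - eapply Rle_trans; [apply Cmod_triangle|].
    rewrite !Cmod_mult, hz, Cmod_R, (Rabs_pos_eq d) by lra. fold e; lra.
  - unfold flow; rewrite RtoC_minus; ring. }
lra.
Qed.

(** The function [t |-> |flow t zeta|^2] has an initial maximum at a point [zeta] of
    the unit circle, and its derivative at [0] is
    [2 Re (conj zeta * lambda (zeta - c)) = 2 (Re lambda - Re (conj zeta * (lambda c)))]. *)
Lemma Re_plus_Cmod_le_0_of_self_map (lambda c : C) :
  (forall t, 0 <= t -> self_map (flow lambda c t)) -> Re lambda + Cmod (lambda * c) <= 0.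
Proof.
intro H.
destruct (exists_opposite_direction (lambda * c)) as [zeta [hz hdir]].
assert (Hd := is_derive_flow_time lambda c 0 zeta); rewrite flow_0 in Hd.
assert (H0 := flow_0 lambda c zeta).
assert (Hx := is_derive_Re _ _ _ Hd).
assert (Hy := is_derive_Im _ _ _ Hd).
set (X := fun s => Re (flow lambda c s zeta)) in *.
set (Y := fun s => Im (flow lambda c s zeta)) in *.
assert (HX0 : X 0 = Re zeta) by (unfold X; now rewrite H0).
assert (HY0 : Y 0 = Im zeta) by (unfold Y; now rewrite H0).
assert (Hn : Re zeta ^ 2 + Im zeta ^ 2 = 1) by (rewrite <- Cmod2_alt, hz; ring).
assert (Hle : 2 * (Re zeta * Re (lambda * (zeta - c)) + Im zeta * Im (lambda * (zeta - c))) <= 0).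
{ apply (is_derive_initial_max (fun s => X s ^ 2 + Y s ^ 2)).
  - evar_last.
    + auto_derive; [|reflexivity].
      repeat split; eexists; [exact Hx | exact Hy].
    + change (fun x => X x) with X; change (fun x => Y x) with Y.
      rewrite (is_derive_unique X _ _ Hx), (is_derive_unique Y _ _ Hy), HX0, HY0; simpl; ring.
  - intros t ht; rewrite HX0, HY0, Hn; unfold X, Y; rewrite <- Cmod2_alt.
    rewrite <- (pow1 2); apply pow_incr; split; [apply Cmod_ge_0|].
    apply flow_unit_circle; [apply H; lra | easy]. }
rewrite <- (Ropp_involutive (Cmod _)), <- hdir.
replace (Re lambda) with (Re lambda * (Re zeta ^ 2 + Im zeta ^ 2)) by (rewrite Hn; ring).
replace (Re lambda * (Re zeta ^ 2 + Im zeta ^ 2) + - Re (Cconj zeta * (lambda * c))) with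
 (Re zeta * Re (lambda * (zeta - c)) + Im zeta * Im (lambda * (zeta - c))).
- lra.
- unfold Re, Im; simpl; ring.
Qed.

(** * Families that agree with the flow on the disc *)

(** The values outside the disc are unspecified, so a semigroup can only be
    compared with the flow on the disc. *)
Definition agrees_with_flow (lambda c : C) (phi : R -> C -> C) : Prop :=
  forall t z, 0 <= t -> unit_disc z -> phi t z = flow lambda c t z.

Lemma semigroup_agrees_with_flow (lambda c : C) (phi : R -> C -> C) :
  is_semigroup phi -> is_generator phi (fun z => (lambda * (z - c))%C) ->
  agrees_with_flow lambda c phi.
Proof.
intros hphi hgen t z ht hz.
rewrite (linear_ode_unique lambda c (fun s => phi s z)); trivial.
- now rewrite (sg_zero phi hphi z hz).
- intros s hs; now apply (gen_derive phi _ hgen).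
Qed.

Lemma agrees_with_flow_is_derive (lambda c : C) (phi : R -> C -> C) (t : R) (z : C) :
  agrees_with_flow lambda c phi -> 0 <= t -> unit_disc z ->
  is_derive (K := C_AbsRing) (V := C_NormedModule) (phi t) z (Cexp (lambda * t)).
Proof.
intros hflow ht hz.
apply is_derive_ext_loc with (2 := is_derive_flow_space lambda c t z).
apply locally_C.
generalize (unit_disc_open z hz); apply filter_imp; intros w hw.
symmetry; now apply hflow.
Qed.

Lemma agrees_with_flow_C_derive (lambda c : C) (phi : R -> C -> C) (t : R) (z : C) :
  agrees_with_flow lambda c phi -> 0 <= t -> unit_disc z ->
  C_derive (phi t) z = Cexp (lambda * t).
Proof.
intros hflow ht hz; apply is_C_derive_unique.
now apply (agrees_with_flow_is_derive lambda c).
Qed.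

Lemma semigroup_Re_plus_Cmod_le_0 (lambda c : C) (phi : R -> C -> C) :
  is_semigroup phi -> is_generator phi (fun z => (lambda * (z - c))%C) ->
  Re lambda + Cmod (lambda * c) <= 0.
Proof.
intros hphi hgen.
apply Re_plus_Cmod_le_0_of_self_map; intros t ht z hz.
rewrite <- (semigroup_agrees_with_flow lambda c phi) by easy.
now apply (sg_self_map phi hphi).
Qed.

Lemma agrees_with_flow_fix (lambda c : C) (phi : R -> C -> C) (t : R) :
  agrees_with_flow lambda c phi -> 0 <= t -> unit_disc c -> phi t c = c.
Proof. intros hflow ht hc; rewrite hflow by easy; unfold flow; ring. Qed.

Lemma agrees_with_flow_linear_fractional (lambda c : C) (phi : R -> C -> C) (t : R) :
  agrees_with_flow lambda c phi -> 0 <= t -> self_map (phi t) ->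
  linear_fractional_self_map (phi t).
Proof.
intros hflow ht hself.
assert (h0 : unit_disc 0) by (unfold unit_disc; rewrite Cmod_0; lra).
assert (h2 : unit_disc (/ 2)%R) by (unfold unit_disc; rewrite Cmod_R, Rabs_pos_eq; lra).
assert (He : Cexp (lambda * t) <> 0%C).
{ apply Cmod_gt_0; rewrite Cmod_Cexp; apply exp_pos. }
split; [exact hself|split].
- exists 0%C, (RtoC (/ 2)); repeat split; trivial.
  rewrite !hflow by easy; unfold flow; intro H.
  assert (H' : (Cexp (lambda * t) * (/ 2)%R = 0)%C).
  { replace (Cexp (lambda * t) * (/ 2)%R)%C with
      (Cexp (lambda * t) * (/ 2)%R + c * (1 - Cexp (lambda * t)) - c * (1 - Cexp (lambda * t)))%C by ring.
    rewrite <- H; ring. }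
  apply (Cmult_neq_0 _ _ He) in H'; trivial.
  intro H2; apply RtoC_inj in H2; lra.
- exists (Cexp (lambda * t)), (c * (1 - Cexp (lambda * t)))%C, 0%C, 1%C; split.
  + rewrite Cmod_0, Cmod_1; lra.
  + intros z hz; rewrite hflow by easy; unfold flow.
    field; apply C1_nz.
Qed.

Lemma agrees_with_flow_attractive (lambda c : C) (phi : R -> C -> C) :
  agrees_with_flow lambda c phi -> Re lambda < 0 -> Cmod c < 1 -> attractive_elliptic_at phi c.
Proof.
intros hflow ha hc; split; [easy|]; intros t ht; split.
- apply (agrees_with_flow_fix lambda); [easy | lra | easy].
- rewrite (agrees_with_flow_C_derive lambda c), Cmod_Cexp, Re_mult_RtoC by (easy || lra).
  rewrite <- exp_0; apply exp_increasing; nra.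
Qed.

Lemma agrees_with_flow_neutral (lambda c : C) (phi : R -> C -> C) :
  agrees_with_flow lambda c phi -> lambda <> 0%C -> Re lambda = 0 -> c = 0%C -> neutral_elliptic_at phi c.
Proof.
intros hflow hl ha hc.
assert (h0 : unit_disc c) by (unfold unit_disc; rewrite hc, Cmod_0; lra).
split; [|split; [easy|]].
- assert (hb : Im lambda <> 0).
  { intro hb; apply hl, injective_projections; assumption. }
  (* At this time [exp (lambda t) = -1]. *)
  set (t := PI / Rabs (Im lambda)).
  assert (hb' := Rabs_pos_lt _ hb).
  assert (ht : 0 <= t) by (left; apply Rdiv_lt_0_compat; [apply PI_RGT_0 | easy]).
  assert (h2 : unit_disc (/ 2)%R) by (unfold unit_disc; rewrite Cmod_R, Rabs_pos_eq; lra).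
  exists t, (RtoC (/ 2)); repeat split; trivial.
  rewrite hflow by easy; intro H.
  apply (f_equal Re) in H; revert H.
  unfold flow, Cexp; rewrite hc, Re_mult_RtoC, Im_mult_RtoC, ha, Rmult_0_l, exp_0.
  replace (cos (Im lambda * t)) with (-1).
  + unfold Re; simpl; lra.
  + unfold t, Rabs in *; destruct (Rcase_abs (Im lambda)).
    * replace (Im lambda * (PI / - Im lambda)) with (- PI) by (field; easy).
      now rewrite cos_neg, cos_PI.
    * replace (Im lambda * (PI / Im lambda)) with PI by (field; easy).
      now rewrite cos_PI.
- intros t ht; split.
  + apply (agrees_with_flow_fix lambda); [easy | lra | easy].
  + rewrite (agrees_with_flow_C_derive lambda c), Cmod_Cexp, Re_mult_RtoC, ha, Rmult_0_l by (easy || lra).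
    apply exp_0.
Qed.

Lemma agrees_with_flow_automorphism (lambda c : C) (phi : R -> C -> C) (t : R) :
  agrees_with_flow lambda c phi -> 0 <= t -> self_map (phi t) ->
  lambda <> 0%C -> Re lambda = 0 -> c = 0%C -> disc_automorphism (phi t).
Proof.
intros hflow ht hself hl ha hc.
assert (hg : self_map (flow (- lambda) 0 t)).
{ apply flow_self_map; trivial.
  - apply Cmod_gt_0; rewrite Cmod_opp; now apply Cmod_gt_0.
  - rewrite Cmult_0_r, Cmod_0; unfold Re in *; simpl; lra. }
assert (He : (Cexp (- lambda * t) * Cexp (lambda * t) = 1)%C).
{ rewrite <- Cexp_plus, <- Cexp_0; f_equal; ring. }
split; [|split; [exact hself|]].
{ intros z hz; eexists; now apply (agrees_with_flow_is_derive lambda c). }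
exists (flow (- lambda) 0 t); repeat split.
- apply flow_holomorphic.
- exact hg.
- intros z hz; rewrite hflow by easy; unfold flow; rewrite hc.
  transitivity (Cexp (- lambda * t) * Cexp (lambda * t) * z)%C; [ring|].
  rewrite He; ring.
- intros z hz; rewrite hflow by auto; unfold flow; rewrite hc.
  transitivity (Cexp (- lambda * t) * Cexp (lambda * t) * z)%C; [ring|].
  rewrite He; ring.
Qed.

Lemma radial_in_disc (tau : C) : Cmod tau = 1 -> at_left 1 (fun r => unit_disc (r * tau)).
Proof.
intro htau.
unfold at_left, within.
generalize (open_gt 0 1 Rlt_0_1); apply filter_imp; intros r hr hr1.
unfold unit_disc; rewrite Cmod_mult, htau, Cmod_R, Rabs_pos_eq; lra.
Qed.

Lemma agrees_with_flow_hyperbolic (lambda c : C) (phi : R -> C -> C) :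
  agrees_with_flow lambda c phi -> Re lambda < 0 -> Im lambda = 0 -> Cmod c = 1 -> hyperbolic_at phi c.
Proof.
intros hflow ha hb hc; split; [easy|]; intros t ht.
assert (He : exp (Re lambda * t) < 1) by (rewrite <- exp_0; apply exp_increasing; nra).
split.
- apply filterlim_Cmod; [typeclasses eauto|]; intro eps.
  assert (Hr : at_left 1 (fun r => 1 - eps < r < 1)).
  { unfold at_left, within.
    generalize (open_gt (1 - eps) 1 ltac:(destruct eps; simpl; lra)).
    apply filter_imp; intros r hr hr1; now split. }
  generalize (filter_and _ _ Hr (radial_in_disc c hc)).
  apply filter_imp; intros r [hr hrc].
  rewrite hflow, flow_centred by (easy || lra).
  replace (c + Cexp (lambda * t) * (r * c - c) - c)%C with
    (Cexp (lambda * t) * ((r - 1)%R * c))%C by (rewrite RtoC_minus; ring).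
  rewrite !Cmod_mult, Cmod_Cexp, Re_mult_RtoC, hc, Cmod_R, Rabs_left by lra.
  generalize (exp_pos (Re lambda * t)); nra.
- exists (exp (Re lambda * t)); split; [|easy].
  apply filterlim_ext_loc with (fun _ => RtoC (exp (Re lambda * t))); [|apply filterlim_const].
  generalize (radial_in_disc c hc); apply filter_imp; intros r hr.
  rewrite (agrees_with_flow_C_derive lambda c) by (easy || lra).
  unfold Cexp; rewrite Re_mult_RtoC, Im_mult_RtoC, hb, Rmult_0_l, cos_0, sin_0.
  apply injective_projections; simpl; ring.
Qed.

(** * The characterisation and the classification *)

Theorem proposition2p4 (lambda c : C) (hlambda : lambda <> 0%C) :
  let G := fun z : C => (lambda * (z - c))%C in
  ((exists phi, is_semigroup phi /\ is_generator phi G)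
     <-> Re lambda + Cmod (lambda * c) <= 0) /\
  forall phi : R -> C -> C, is_semigroup phi -> is_generator phi G ->
    (forall t, 0 <= t -> linear_fractional_self_map (phi t)) /\
    (forall t z, 0 <= t -> unit_disc z ->
       phi t z = (Cexp (lambda * t) * z + c * (1 - Cexp (lambda * t)))%C) /\
    (Cmod c <= 1 /\ is_Denjoy_Wolff_point phi c) /\
    (Re lambda = 0 ->
       c = 0%C /\ neutral_elliptic phi /\
       forall t, 0 <= t -> disc_automorphism (phi t)) /\
    (0 < Rabs (Re lambda) < Cmod lambda ->
       Cmod c < 1 /\
       Rabs (Re lambda) >= Rabs (Im lambda) * (Cmod c / sqrt (1 - Cmod c ^ 2)) /\
       Re lambda < 0 /\
       attractive_elliptic phi) /\
    (Rabs (Re lambda) = Cmod lambda ->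
       (Im lambda = 0 /\ Re lambda < 0) /\
       ((Cmod c < 1 /\ attractive_elliptic phi) \/
        (Cmod c = 1 /\ hyperbolic phi))).
Proof.
intro G; split; [split|].
- intros [phi [hphi hgen]]; now apply (semigroup_Re_plus_Cmod_le_0 lambda c phi).
- intro hc; exists (flow lambda c); split; [now apply flow_semigroup | apply flow_generator].
- intros phi hphi hgen.
  assert (hcond := semigroup_Re_plus_Cmod_le_0 lambda c phi hphi hgen).
  assert (hflow := semigroup_agrees_with_flow lambda c phi hphi hgen).
  assert (hself := sg_self_map phi hphi).
  rewrite Cmod_mult in hcond.
  assert (hl := proj1 (Cmod_gt_0 lambda) hlambda).
  assert (hc0 := Cmod_ge_0 c).
  assert (ha : Re lambda <= 0) by nra.
  assert (hal : Rabs (Re lambda) <= Cmod lambda) by apply re_le_Cmod.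
  rewrite Rabs_left1 in * by easy.
  assert (hc1 : Cmod c <= 1) by nra.
  assert (hl2 : Cmod lambda ^ 2 = Re lambda ^ 2 + Im lambda ^ 2) by apply Cmod2_alt.
  assert (hzero : Re lambda = 0 -> c = 0%C) by (intro h; apply Cmod_eq_0; nra).
  assert (hneg : Re lambda < 0 -> Cmod c < 1 -> attractive_elliptic_at phi c)
    by now apply (agrees_with_flow_attractive lambda c phi).
  assert (hbd : Cmod c = 1 -> Re lambda < 0 /\ Im lambda = 0).
  { intro h; rewrite h in hcond.
    assert (hml : Cmod lambda = - Re lambda) by lra.
    rewrite hml in hl2; split; [lra|].
    apply Rsqr_0_uniq; rewrite Rsqr_pow2; lra. }
  assert (hhyp : Cmod c = 1 -> hyperbolic_at phi c)
    by (intro h; apply (agrees_with_flow_hyperbolic lambda c phi); tauto).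
  split; [|split; [|split; [|split; [|split]]]].
  + intros t ht; apply (agrees_with_flow_linear_fractional lambda c phi); auto.
  + exact hflow.
  + split; [easy|].
    destruct (Rle_lt_or_eq_dec _ _ ha) as [h|h].
    * destruct (Rle_lt_or_eq_dec _ _ hc1) as [h'|h'].
      -- right; left; now apply hneg.
      -- right; right; left; now apply hhyp.
    * left; apply (agrees_with_flow_neutral lambda c phi); auto.
  + intro h; assert (hc := hzero h); split; [easy|split].
    * exists c; now apply (agrees_with_flow_neutral lambda c phi).
    * intros t ht; apply (agrees_with_flow_automorphism lambda c phi); auto.
  + intros [h0 h1].
    assert (hlt : Cmod c < 1) by nra.
    split; [easy|split; [|split; [lra | exists c; apply hneg; lra]]].
    assert (hs : 0 < 1 - Cmod c ^ 2) by nra.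
    assert (hsq := sqrt_lt_R0 _ hs).
    apply Rle_ge, Rmult_le_reg_r with (sqrt (1 - Cmod c ^ 2)); [easy|].
    replace (Rabs (Im lambda) * (Cmod c / sqrt (1 - Cmod c ^ 2)) * sqrt (1 - Cmod c ^ 2)) with
      (Rabs (Im lambda) * Cmod c) by (field; lra).
    apply Rsqr_incr_0_var; [|apply Rmult_le_pos; lra].
    rewrite !Rsqr_mult, <- Rsqr_abs, Rsqr_sqrt by lra.
    rewrite !Rsqr_pow2.
    (* Expanding [|lambda|^2] in [|lambda c|^2 <= (Re lambda)^2] gives
       [(Im lambda)^2 |c|^2 <= (Re lambda)^2 (1 - |c|^2)]. *)
    assert (H : (Cmod lambda * Cmod c) ^ 2 <= (- Re lambda) ^ 2).
    { apply pow_incr; split; [apply Rmult_le_pos|]; lra. }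
    rewrite Rpow_mult_distr, hl2 in H. lra.
  + intro h; rewrite <- h in hl2; split; [split; [|lra]|].
    * apply Rsqr_0_uniq; rewrite Rsqr_pow2; lra.
    * destruct (Rle_lt_or_eq_dec _ _ hc1) as [h'|h'].
      -- left; split; [easy|]; exists c; apply hneg; lra.
      -- right; split; [easy|]; exists c; now apply hhyp.
Qed.
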